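(* Let $(C_n)_{n\ge1}$ be a $\mathrm{Sym}$-invariant chain of cones with limit $C=\bigcup_{n\ge1}C_n\subseteq\mathbb{R}^{(\mathbb{N})}$. The following are equivalent: (i) the chain stabilizes, and $C_n$ is finitely generated for all sufficiently large $n$; (ii) there exist $p\in\mathbb{N}$ and a finite set $G_p\subseteq\mathbb{R}^p$ such that $C_n=\mathrm{cone}(\mathrm{Sym}(n)(G_p))$ for all $n\ge p$; (iii) there exists $q\in\mathbb{N}$ such that for all $n\ge q$: (a) $C\cap\mathbb{R}^n=C_n$, and (b) $C_n$ is generated (as a cone) by finitely many elements each of support size at most $q$; (iv) $C$ is $\mathrm{Sym}$-equivariantly finitely generated.
   Context: $\mathbb{R}^{(\mathbb{N})}$ denotes the space of real sequences $(u_i)_{i\in\mathbb{N}}$ with only finitely many nonzero entries; $\mathbb{R}^n$ is identified with the subspace of those with $u_i=0$ for $i>n$. $\mathrm{Sym}$ is the group of permutations of $\mathbb{N}$ fixing all but finitely many elements, acting by $\sigma(u)=\sum_iu_ie_{\sigma(i)}$; $\mathrm{Sym}(n)$ is the subgroup of permutations of $[n]$, acting on $\mathbb{R}^n$. $\mathrm{cone}(A)$ is the set of finite nonnegative linear combinations of elements of $A$; $\Gamma(A)=\{\sigma(a)\mid\sigma\in\Gamma,a\in A\}$. A $\mathrm{Sym}$-invariant chain of cones is a sequence $(C_n)_{n\ge1}$ with each $C_n\subseteq\mathbb{R}^n$ a $\mathrm{Sym}(n)$-invariant convex cone and $C_n\subseteq C_{n+1}$; it stabilizes if there is $r$ with $C_n=\mathrm{cone}(\mathrm{Sym}(n)(C_m))$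 for all $n\ge m\ge r$. A $\mathrm{Sym}$-invariant cone $C$ is $\mathrm{Sym}$-equivariantly finitely generated if $C=\mathrm{cone}(\mathrm{Sym}(A))$ for some finite $A$. The support size of $u$ is $|\{i\mid u_i\neq0\}|$. *)

(* Defs.v *)
From mathcomp Require Import all_boot all_order all_algebra.
From mathcomp Require Import finmap.
From mathcomp Require Import boolp classical_sets functions cardinality reals.
From mathcomp.multinomials Require Import monalg.

Set Implicit Arguments.
Unset Strict Implicit.
Unset Printing Implicit Defensive.

Import GRing.Theory Num.Theory.

Local Open Scope classical_set_scope.
Local Open Scope ring_scope.

(* Coordinates are numbered from 0, so that [n] is {0, ..., n - 1}; dimensions
   and the indices of a chain are the positive naturals.
   R^(N) is the free R-module on nat: [{malg R[nat]}], used only as a module. *)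
Notation seqspace R := {malg R[nat]}.

Section Defs.
Variable R : realType.
Implicit Types (A K : set (seqspace R)) (u : seqspace R) (s : nat -> nat).
Implicit Types (S : set (nat -> nat)) (C : nat -> set (seqspace R)).

Definition eucl (n : nat) : set (seqspace R) :=
  [set u | forall i, (n <= i)%N -> u@_i = 0].

Definition support_size u : nat := #|` msupp u|%fset.

Definition Sym : set (nat -> nat) :=
  [set s | bijective s /\ finite_set [set i | s i <> i]].

Definition Symn (n : nat) : set (nat -> nat) :=
  [set s | bijective s /\ forall i, (n <= i)%N -> s i = i].

(* sigma(u) = sum_i u_i e_(sigma i), where [<< c *g k >>] is c e_k. *)
Definition permact s u : seqspace R :=
  \sum_(i <- msupp u) << u@_i *g s i >>.

Definition translates S A : set (seqspace R) :=
  [set permact s u | s in S & u in A].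

(* The empty combination (k = 0) is allowed: the cone of the empty set is 0. *)
Definition cone A : set (seqspace R) :=
  [set x | exists (k : nat) (c : 'I_k -> R) (v : 'I_k -> seqspace R),
     [/\ forall j, 0 <= c j, forall j, A (v j) & x = \sum_j c j *: v j]].

Definition convex_cone K : Prop :=
  [/\ K 0, forall u v, K u -> K v -> K (u + v)
    & forall a u, 0 <= a -> K u -> K (a *: u)].

Definition invariant S A : Prop := translates S A `<=` A.

Definition finitely_generated K : Prop :=
  exists2 A, finite_set A & K = cone A.

(* The value of a chain at the index 0 is irrelevant. *)
Definition Sym_invariant_chain C : Prop :=
  forall n, (0 < n)%N ->
    [/\ C n `<=` eucl n, convex_cone (C n), invariant (Symn n) (C n)
      & C n `<=` C n.+1].

Definition chain_limit C : set (seqspace R) :=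
  \bigcup_(n in [set n | (0 < n)%N]) C n.

Definition stabilizes C : Prop :=
  exists2 r, (0 < r)%N & forall m n, (r <= m)%N -> (m <= n)%N ->
    C n = cone (translates (Symn n) (C m)).

Definition Sym_equivariantly_fg K : Prop :=
  exists2 A, finite_set A & K = cone (translates Sym A).

End Defs.
Arguments eucl : clear implicits.

(* Main.v *)
(** The heart of the matter is that if [A] is contained in R^p and [3p <= n],
then every [u] in R^n and in cone(Sym(A)) already lies in cone(Sym(n)(A)).  For
[v = sigma(g)] with [g] in [A], let [t] be the sum of the coordinates of [v]
beyond [n].  Given a p-subset [T] of [n] disjoint from [sigma [p]], moving the
coordinates beyond [n] onto [T] and averaging over the cyclic shifts of [T]
shows that (v restricted to [n]) + (t / p) 1_T lies in cone(Sym(n)(A)).  Now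
write [u] as a nonnegative combination of such [v]: its [t] vanishes, so
Fourier-Motzkin elimination of [t] expresses [u] through terms with [t = 0] and
combinations of two terms with opposite signs of [t].  Such a pair occupies at
most 2p coordinates in [n], so a common [T] exists and the 1_T terms cancel. *)
From HB Require Import structures.
Require Import Defs.
From mathcomp Require Import all_boot all_order all_algebra.
From mathcomp Require Import finmap.
From mathcomp Require Import boolp classical_sets functions cardinality reals.
From mathcomp.multinomials Require Import monalg.

Set Implicit Arguments.
Unset Strict Implicit.
Unset Printing Implicit Defensive.

Import Order.TTheory GRing.Theory Num.Theory.

Local Open Scope classical_set_scope.
Local Open Scope ring_scope.

(** * Uniform bounds over finite sets, and finite dimension of each vector *)

Lemma finite_set_bound (T : choiceType) (A : set T) (P : T -> nat -> Prop) :
  finite_set A -> (forall x m n, (m <= n)%N -> P x m -> P x n) ->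
  (forall x, A x -> exists n, P x n) ->
  exists n, forall x, A x -> P x n.
Proof.
move=> /finite_seqP[s ->] Pmono; elim: s => [|x s IHs] Pex; first by exists 0%N.
have [y ys|n nP] := IHs; first by apply: Pex => /=; rewrite inE ys orbT.
have [|m mP] := Pex x; first by rewrite /= inE eqxx.
exists (maxn m n) => y /=; rewrite inE => /predU1P[->|/nP].
  exact: Pmono (leq_maxl m n) mP.
exact: Pmono (leq_maxr m n).
Qed.

Lemma ex_eucl (R : realType) (u : seqspace R) : exists n, eucl R n u.
Proof.
have [n nP] := @finite_set_bound nat [set` msupp u] (fun i n => (i < n)%N)
  (finite_fset _) (fun x m n mn xm => leq_trans xm mn)
  (fun x _ => ex_intro _ x.+1 (ltnSn x)).
exists n => i ni; apply/eqP; rewrite mcoeff_eq0; apply/negP => /nP.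
by rewrite ltnNge ni.
Qed.

Lemma eucl_le (R : realType) m n (u : seqspace R) :
  (m <= n)%N -> eucl R m u -> eucl R n u.
Proof. by move=> mn um i ni; apply: um; apply: leq_trans ni. Qed.

(** * Linear extension from the basis vectors *)

Section LinearExtension.
Context {R : realType} {V : lmodType R}.
Implicit Types (f : nat -> V) (u : seqspace R).

(** The permutation action, truncation and the tail sum are all of this shape, so identities between
    them reduce to identities on basis vectors. *)
Definition linext f u : V := \sum_(i <- msupp u) u@_i *: f i.

(** The support of a sum can be smaller than the union of the supports; an index range common to all
    the vectors involved makes linearity a termwise computation. *)
Lemma linextEw f u n : eucl R n u -> linext f u = \sum_(0 <= i < n) u@_i *: f i.
Proof.
move=> un; rewrite /linext.
rewrite [RHS](bigID (mem (msupp u))) /= [X in _ + X]big1 ?addr0; last first.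
  by move=> i /mcoeff_outdom ->; rewrite scale0r.
rewrite -[RHS]big_filter; apply: perm_big; apply: uniq_perm.
- exact: fset_uniq.
- by rewrite filter_uniq ?iota_uniq.
move=> i; rewrite mem_filter mem_index_iota /=.
have [iu|//] := boolP (i \in msupp u); rewrite ltnNge; apply/esym/negP => /un.
by apply/eqP; rewrite mcoeff_neq0.
Qed.

Lemma linext_is_linear f : linear (linext f).
Proof.
move=> a u v; have [m um] := ex_eucl u; have [n vn] := ex_eucl v.
have {}um := eucl_le (leq_maxl m n) um; have {}vn := eucl_le (leq_maxr m n) vn.
have uvn : eucl R (maxn m n) (a *: u + v).
  by move=> i ni; rewrite mcoeffD mcoeffZ um // vn // mulr0 addr0.
rewrite (linextEw f um) (linextEw f vn) (linextEw f uvn) scaler_sumr -big_split.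
by apply: eq_bigr => i _ /=; rewrite mcoeffD mcoeffZ scalerDl scalerA.
Qed.

HB.instance Definition _ f :=
  GRing.isLinear.Build R (seqspace R) V *:%R (linext f) (linext_is_linear f).

Lemma linextU f c i : linext f << c *g i >> = c *: f i.
Proof.
rewrite /linext msuppU; have [->|_] := eqVneq c 0.
  by rewrite big_seq_fset0 scale0r.
by rewrite big_seq_fset1 mcoeffUU.
Qed.

Lemma eq_linext f g u :
  (forall i, u@_i != 0 -> f i = g i) -> linext f u = linext g u.
Proof.
move=> fg; rewrite /linext !big_seq; apply: eq_bigr => i iu.
by rewrite fg ?mcoeff_neq0.
Qed.

Lemma linext_sum (I : Type) (r : seq I) (f : I -> nat -> V) u :
  \sum_(k <- r) linext (f k) u = linext (fun i => \sum_(k <- r) f k i) u.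
Proof.
rewrite /linext exchange_big; apply: eq_bigr => i _.
by rewrite scaler_sumr.
Qed.

Lemma linextZ a f u : a *: linext f u = linext (fun i => a *: f i) u.
Proof.
rewrite /linext scaler_sumr; apply: eq_bigr => i _.
by rewrite !scalerA mulrC.
Qed.

End LinearExtension.

Lemma linear_linext (R : realType) (V W : lmodType R) (h : {linear V -> W})
    (f : nat -> V) (u : seqspace R) :
  h (linext f u) = linext (h \o f) u.
Proof. by rewrite /linext linear_sum; apply: eq_bigr => i _; rewrite linearZ. Qed.

(** * The action on coordinates and its effect on supports *)

Section Permact.
Context {R : realType}.
Implicit Types (A K : set (seqspace R)) (u v : seqspace R) (s : nat -> nat).

Lemma malgUE (c : R) (i : nat) : << c *g i >> = c *: << i >> :> seqspace R.
Proof. by apply/malgP => j; rewrite mcoeffZ !mcoeffU mulrnAr mulr1. Qed.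

Lemma permactE s u : permact s u = linext (fun i => << s i >> : seqspace R) u.
Proof. by apply: eq_bigr => i _; rewrite malgUE. Qed.

Lemma linext_id u : linext (fun i => << i >> : seqspace R) u = u.
Proof. by rewrite [RHS]monalgE /linext; apply: eq_bigr => i _; rewrite -malgUE. Qed.

Lemma linext_permact (V : lmodType R) (f : nat -> V) s u :
  linext f (permact s u) = linext (f \o s) u.
Proof.
by rewrite permactE linear_linext; apply: eq_linext => i _ /=; rewrite linextU scale1r.
Qed.

Lemma permact_comp s t u : permact s (permact t u) = permact (s \o t) u.
Proof. by rewrite permactE linext_permact permactE. Qed.

Lemma permact_id s u : (forall i, s i = i) -> permact s u = u.
Proof.
by move=> sid; rewrite -[RHS]linext_id permactE; apply: eq_linext => i _; rewrite sid.
Qed.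

Lemma msupp_permact s u k :
  k \in msupp (permact s u) -> exists2 i, i \in msupp u & k = s i.
Proof.
rewrite -mcoeff_neq0 /permact raddf_sum /=; apply: contra_neqP => nk.
rewrite big_seq big1 // => i iu; rewrite mcoeffU.
by have [si|] := eqVneq; rewrite ?mulr0n //; case: nk; exists i.
Qed.

Lemma support_size_permact s u : (support_size (permact s u) <= support_size u)%N.
Proof.
rewrite /support_size -(size_map s (msupp u)); apply: uniq_leq_size => // k.
by case/msupp_permact => i iu ->; apply: map_f.
Qed.

Lemma eucl_permact n s u :
  (forall i, u@_i != 0 -> (s i < n)%N) -> eucl R n (permact s u).
Proof.
move=> sn k nk; apply/eqP; rewrite mcoeff_eq0; apply/negP => /msupp_permact[i].
by rewrite -mcoeff_neq0 => /sn + ki; rewrite -ki ltnNge nk.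
Qed.

Lemma eucl_msupp n u i : eucl R n u -> u@_i != 0 -> (i < n)%N.
Proof. by move=> un; apply: contra_neqT; rewrite -leqNgt => /un. Qed.

Lemma support_size_eucl n u : eucl R n u -> (support_size u <= n)%N.
Proof.
move=> un; rewrite /support_size -[leqRHS](size_iota 0).
apply: uniq_leq_size => // i; rewrite mem_iota add0n /= -mcoeff_neq0.
exact: eucl_msupp.
Qed.

End Permact.

(** * Convex cones and elimination of a linear form *)

Section Cone.
Context {R : realType}.
Implicit Types (A B K : set (seqspace R)) (u v : seqspace R).

Lemma convex_cone_sum K (I : Type) (r : seq I) (P : pred I) (F : I -> seqspace R) :
  convex_cone K -> (forall i, P i -> K (F i)) -> K (\sum_(i <- r | P i) F i).
Proof. by case=> K0 KD _ KF; elim/big_ind: _. Qed.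

Lemma cone_min A K : convex_cone K -> A `<=` K -> cone A `<=` K.
Proof.
move=> Kcone AK x [k [c [v [c0 Av ->]]]]; apply: convex_cone_sum => // j _.
by case: Kcone => _ _; apply => //; apply: AK.
Qed.

Lemma sub_cone A : A `<=` cone A.
Proof.
move=> x Ax; exists 1%N, (fun=> 1), (fun=> x); split => //.
by rewrite big_ord1 scale1r.
Qed.

Lemma cone_convex_cone A : convex_cone (cone A).
Proof.
split.
- exists 0%N, (fun=> 0), (fun=> 0); split => //; last by rewrite big_ord0.
  by case.
- move=> u v [k [c [x [c0 Ax ->]]]] [l [d [y [d0 Ay ->]]]].
  exists (k + l)%N, (fun j => match fintype.split j with inl i => c i | inr i => d i end),
    (fun j => match fintype.split j with inl i => x i | inr i => y i end).
  split; [by move=> j; case: fintype.split..|].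
  rewrite big_split_ord /=; congr (_ + _); apply: eq_bigr => i _.
    by rewrite (unsplitK (inl i)).
  by rewrite (unsplitK (inr i)).
- move=> a u a0 [k [c [x [c0 Ax ->]]]].
  exists k, (fun j => a * c j), x; split => //.
    by move=> j; rewrite mulr_ge0.
  by rewrite scaler_sumr; apply: eq_bigr => i _; rewrite scalerA.
Qed.
Hint Resolve cone_convex_cone : core.

Lemma cone_mono A B : A `<=` B -> cone A `<=` cone B.
Proof. by move=> AB; apply: cone_min => // x /AB; apply: sub_cone. Qed.

(** The action is linear, so a translate of a conical combination is the same combination of
    translates. *)
Lemma cone_translates (S : set (nat -> nat)) A :
  cone (translates S (cone A)) = cone (translates S A).
Proof.
apply/seteqP; split; last first.
  apply: cone_mono => _ [s Ss [u Au <-]]; exists s => //; exists u => //.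
  exact: sub_cone.
apply: cone_min => // _ [s Ss [u [k [c [v [c0 Av ->]]]] <-]].
rewrite permactE linear_sum; apply: convex_cone_sum => // j _.
case: (cone_convex_cone (translates S A)) => _ _; rewrite linearZ /=; apply => //.
by rewrite -permactE; apply: sub_cone; exists s => //; exists (v j).
Qed.

(* Fourier-Motzkin elimination of the coordinate [s]. *)
Lemma convex_cone_elim K (k : nat) (c s : 'I_k -> R) (x : 'I_k -> seqspace R) :
  convex_cone K -> (forall j, 0 <= c j) -> \sum_j c j * s j = 0 ->
  (forall j, s j = 0 -> K (x j)) ->
  (forall i j, 0 < s i -> s j < 0 -> K (- s j *: x i + s i *: x j)) ->
  K (\sum_j c j *: x j).
Proof.
move=> Kcone c0 cs0 Kx0 Kx2; have [K0 KD KZ] := Kcone.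
pose P := \sum_(j | 0 < s j) c j * s j.
pose N := \sum_(j | s j < 0) c j * - s j.
have split3 (W : zmodType) (F : 'I_k -> W) : \sum_j F j =
    \sum_(j | 0 < s j) F j + \sum_(j | s j < 0) F j + \sum_(j | s j == 0) F j.
  rewrite (bigID (fun j => 0 < s j)) /= -addrA; congr (_ + _).
  rewrite (bigID (fun j => s j < 0)) /=; congr (_ + _); apply: eq_bigl => j;
    by rewrite ?andbT //; case: (ltgtP (s j) 0).
(* The vanishing of the weighted sum of [s] says that its positive and negative parts have equal
   mass. *)
have PN : P = N.
  have := cs0; rewrite split3 [X in _ + X]big1 ?addr0; last first.
    by move=> j /eqP ->; rewrite mulr0.
  move/eqP; rewrite addr_eq0 -sumrN => /eqP; rewrite -/P => ->.
  by apply: eq_bigr => j _; rewrite mulrN.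
have P0 : 0 <= P by apply: sumr_ge0 => j sj; rewrite mulr_ge0 // ltW.
(* If the common mass is 0, then [c j = 0] whenever [s j] is nonzero, and only terms with [s j = 0]
   remain. *)
have [P_eq0|P_neq0] := eqVneq P 0.
  apply: convex_cone_sum => // j _.
  have [sj|sj|/eqP] := ltgtP (s j) 0; last by move=> /eqP sj; apply: KZ => //; apply: Kx0.
    have := P_eq0; rewrite PN => /psumr_eq0P => /(_ _ j sj) /eqP.
    rewrite mulf_eq0 oppr_eq0 (lt_eqF sj) orbF => /(_ _)/eqP -> //.
      by rewrite scale0r.
    by move=> i si; rewrite mulr_ge0 // oppr_ge0 ltW.
  have := P_eq0 => /psumr_eq0P => /(_ _ j sj) /eqP.
  rewrite mulf_eq0 (gt_eqF sj) orbF => /(_ _)/eqP -> //.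
    by rewrite scale0r.
  by move=> i si; rewrite mulr_ge0 // ltW.
rewrite split3; apply: KD; last first.
  by apply: convex_cone_sum => // j /eqP sj; apply: KZ => //; apply: Kx0.
(* In the double sum, summing over [j] first gives each [c i *: x i] the factor [N], and summing
   over [i] first gives each [c j *: x j] the factor [P]; as [P = N], dividing by [P] recovers the
   left side. *)
suff -> : \sum_(j | 0 < s j) c j *: x j + \sum_(j | s j < 0) c j *: x j =
    P^-1 *: \sum_(i | 0 < s i) \sum_(j | s j < 0)
              (c i * c j) *: (- s j *: x i + s i *: x j).
  apply: (KZ); first by rewrite invr_ge0.
  apply: convex_cone_sum => // i si; apply: convex_cone_sum => // j sj.
  by apply: KZ; [rewrite mulr_ge0|apply: Kx2].
apply: (scalerI P_neq0); rewrite scalerA divff // scale1r scalerDr {1}PN.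
under [RHS]eq_bigr do under eq_bigr do rewrite scalerDr.
under [RHS]eq_bigr do rewrite big_split /=.
rewrite big_split /=; congr (_ + _).
  rewrite scaler_sumr; apply: eq_bigr => i _; rewrite /N scalerA mulr_suml scaler_suml.
  by apply: eq_bigr => j _; rewrite !scalerA [_ * c i]mulrC mulrA.
rewrite exchange_big /= scaler_sumr; apply: eq_bigr => j _.
rewrite /P scalerA mulr_suml scaler_suml.
by apply: eq_bigr => i _; rewrite !scalerA mulrAC.
Qed.

End Cone.
#[export] Hint Resolve cone_convex_cone : core.

Section FinitaryPermutations.
Implicit Types (s t f : nat -> nat).

Lemma Symn_id n : Symn n id.
Proof. by split => //; exists id. Qed.

Lemma Symn_comp n s t : Symn n s -> Symn n t -> Symn n (s \o t).
Proof.
move=> [sb sn] [tb tn]; split; first exact: bij_comp.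
by move=> i ni /=; rewrite tn ?sn.
Qed.

Lemma Symn_inv n s : Symn n s -> exists2 t, Symn n t & cancel s t /\ cancel t s.
Proof.
move=> [[t sK tK] sn]; exists t => //; split; first by exists s.
by move=> i ni; rewrite -{1}[i]sn ?sK.
Qed.

Lemma Symn_le m n s : (m <= n)%N -> Symn m s -> Symn n s.
Proof. by move=> mn [sb sm]; split => // i ni; apply: sm; apply: leq_trans ni. Qed.

(** A value [s i] beyond [n] would be fixed by [s], and injectivity would force [s i = i]. *)
Lemma Symn_lt n s i : Symn n s -> (i < n)%N -> (s i < n)%N.
Proof.
move=> [/bij_inj sI sn] ltin; rewrite ltnNge; apply/negP => nsi.
by have /sI si := sn _ nsi; rewrite si leqNgt ltin in nsi.
Qed.

Lemma Symn_Sym n : Symn n `<=` Sym.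
Proof.
move=> s [sb sn]; split => //; apply: sub_finite_set (finite_II n) => i /= si.
by rewrite ltnNge; apply/negP => /sn.
Qed.

Lemma Sym_Symn s : Sym s -> exists n, Symn n s.
Proof.
move=> [sb /finite_set_bound sfin].
have [n nP] := sfin (fun i n => (i < n)%N) (fun x m n mn xm => leq_trans xm mn)
  (fun x _ => ex_intro _ x.+1 (ltnSn x)).
exists n; split => // i ni; apply: contrapT => /nP.
by rewrite ltnNge ni.
Qed.

Lemma Symn_swap n a b : (a < n)%N -> (b < n)%N ->
  exists2 s, Symn n s & s a = b /\ (forall i, i != a -> i != b -> s i = i).
Proof.
move=> an bn; pose s i := if i == a then b else if i == b then a else i.
have sK : involutive s.
  move=> i; rewrite /s; have [->|ia] := eqVneq i a.
    by rewrite eqxx; case: eqVneq.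
  have [->|ib] := eqVneq i b; first by rewrite eqxx.
  by rewrite (negbTE ia) (negbTE ib).
exists s; last by split=> [|i /negbTE ia /negbTE ib]; rewrite /s ?eqxx ?ia ?ib.
split=> [|i ni]; first exact: inv_bij.
by rewrite /s !gtn_eqF // (leq_trans _ ni).
Qed.

Lemma Symn_extend p n f : (p <= n)%N ->
  (forall i, (i < p)%N -> (f i < n)%N) ->
  (forall i j, (i < p)%N -> (j < p)%N -> f i = f j -> i = j) ->
  exists2 s, Symn n s & forall i, (i < p)%N -> s i = f i.
Proof.
elim: p => [|p IHp] ltpn fn fI; first by exists id => //; exact: Symn_id.
have [||s sn sf] := IHp (ltnW ltpn).
- by move=> i ip; apply: fn; apply: ltnW.
- by move=> i j ip jp; apply: fI; apply: ltnW.
(* Correct the value at [p] by exchanging [s p] with [f p]. The earlier values avoid both points, by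
   injectivity of [s] and of [f]. *)
have [t tn [tp tid]] := Symn_swap (Symn_lt sn ltpn) (fn _ (ltnSn p)).
exists (t \o s); first exact: Symn_comp.
move=> i; rewrite ltnS leq_eqVlt => /predU1P[->|ip] //=.
rewrite sf // tid //.
  rewrite -sf //; apply/eqP => /(bij_inj sn.1) eq_ip.
  by rewrite eq_ip ltnn in ip.
by apply/eqP => /(fI _ _ (leqW ip) (ltnSn p)) eq_ip; rewrite eq_ip ltnn in ip.
Qed.

Lemma finite_Symn n : finite_set (Symn n).
Proof.
(* A permutation of [n] is recovered from its restriction to [n], and there are finitely many
   self-maps of [n]. *)
pose ext (g : {ffun 'I_n -> 'I_n}) i :=
  if insub i is Some j then g j : nat else i.
have /sub_finite_set : Symn n `<=` ext @` setT.
  move=> s ssn; exists [ffun j : 'I_n => Ordinal (Symn_lt ssn (ltn_ord j))] => //.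
  apply/funext => i; rewrite /ext; case: insubP => [j _ <-|].
    by rewrite ffunE.
  by rewrite -leqNgt => /(proj2 ssn) ->.
by apply; apply: finite_image; apply: finite_finset.
Qed.

Lemma fresh_seq p n (X : seq nat) : (size X + p <= n)%N ->
  exists T : seq nat, [/\ uniq T, size T = p,
    forall i, i \in T -> (i < n)%N & forall i, i \in T -> i \notin X].
Proof.
move=> Xpn; pose L := [seq i <- iota 0 n | i \notin X].
(* At most [size X] elements of [n] are excluded, so at least [p] survive. *)
have sL : (p <= size L)%N.
  rewrite size_filter -(leq_add2l (count (mem X) (iota 0 n))).
  rewrite (count_predC (mem X)) size_iota; apply: leq_trans Xpn.
  rewrite leq_add2r -size_filter; apply: uniq_leq_size.
    by rewrite filter_uniq ?iota_uniq.
  by move=> i; rewrite mem_filter => /andP[].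
have LP i : i \in take p L -> (i < n)%N /\ i \notin X.
  by move/mem_take; rewrite mem_filter mem_iota => /andP[].
exists (take p L); split.
- by rewrite take_uniq // filter_uniq ?iota_uniq.
- by rewrite size_take_min; apply/minn_idPl.
- by move=> t /LP[].
- by move=> t /LP[].
Qed.

End FinitaryPermutations.

(** * Truncation to R^n and descent from Sym to Sym(n) *)

Section Truncation.
Context {R : realType}.
Implicit Types (A : set (seqspace R)) (u v w g : seqspace R) (s : nat -> nat).

Definition trunc n u : seqspace R :=
  linext (fun i => if (i < n)%N then << i >> else 0) u.

(** The sum of the coordinates of index at least [n]. Taking values in [R^o], that is [R] as a
    module over itself, makes it an instance of [linext]. *)
Definition tail n u : R := linext (fun i => (n <= i)%N%:R : R^o) u.

Lemma trunc_eucl n u : eucl R n u -> trunc n u = u.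
Proof.
move=> un; rewrite -[RHS]linext_id; apply: eq_linext => i /(eucl_msupp un) ->.
by [].
Qed.

Lemma tail_eucl n u : eucl R n u -> tail n u = 0.
Proof.
move=> un; rewrite /tail /linext big_seq big1 // => i.
by rewrite -mcoeff_neq0 => /(eucl_msupp un) iu; rewrite leqNgt iu scaler0.
Qed.

Lemma trunc_tail n w u :
  trunc n u + tail n u *: w = linext (fun i => if (i < n)%N then << i >> else w) u.
Proof.
rewrite /trunc /tail /linext scaler_suml -big_split /=; apply: eq_bigr => i _.
case: ltnP => _; rewrite ?scaler0 ?scale0r ?addr0 ?add0r //.
by rewrite -[u@_i *: _]/(u@_i * 1) mulr1.
Qed.

(* The coordinates of [permact s g] beyond [n] are moved onto [T], and the
   result is averaged over the cyclic shifts of [T]. *)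
Lemma cone_trunc_tail p n A g s (T : seq nat) :
  (p < n)%N -> A g -> eucl R p.+1 g -> injective s ->
  uniq T -> size T = p.+1 -> (forall t, t \in T -> (t < n)%N) ->
  (forall i, (i < p.+1)%N -> s i \notin T) ->
  cone (translates (Symn n) A)
    (trunc n (permact s g)
     + tail n (permact s g) *: (p.+1%:R^-1 *: \sum_(t <- T) << t >>)).
Proof.
move=> ltpn Ag gp sI Tuniq sT Tn sT'.
(* Positions already inside [n] stay; the others go to the entry of [T] at their original index [i],
   shifted cyclically by [k]. *)
pose tau (k : 'I_p.+1) i :=
  if (s i < n)%N then s i else nth 0%N T ((i + k) %% p.+1).
have ltT i (k : 'I_p.+1) : ((i + k) %% p.+1 < size T)%N by rewrite sT ltn_mod.
have /choice[sigma sigmaP] (k : 'I_p.+1) : exists t, Symn n t /\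
    forall i, (i < p.+1)%N -> t i = tau k i.
  have [|||t] := @Symn_extend p.+1 n (tau k) => //; last by exists t.
    by move=> i ip; rewrite /tau; case: ifP => // _; rewrite Tn ?mem_nth.
  (* Injectivity on [p+1]: a mixed case would put some [s i] into [T], and inside [T] distinct
     residues give distinct entries. *)
  move=> i j ip jp; rewrite /tau; case: ifP => [_|_]; case: ifP => [_|_].
  - exact: sI.
  - by move=> si; move: (sT' i ip); rewrite si mem_nth.
  - by move=> /esym sj; move: (sT' j jp); rewrite sj mem_nth.
  - move/eqP; rewrite nth_uniq // eqn_modDr !modn_small // => /eqP.
    by [].
suff -> : trunc n (permact s g)
     + tail n (permact s g) *: (p.+1%:R^-1 *: \sum_(t <- T) << t >>) =
    p.+1%:R^-1 *: \sum_k permact (sigma k) g.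
  case: (cone_convex_cone (translates (Symn n) A)) => _ _; apply.
    by rewrite invr_ge0.
  apply: convex_cone_sum => // k _; apply: sub_cone.
  by exists (sigma k); [case: (sigmaP k)|exists g].
rewrite trunc_tail linext_permact.
under [in RHS]eq_bigr do rewrite permactE.
rewrite linext_sum linextZ; apply: eq_linext => i /(eucl_msupp gp) ip /=.
under [in RHS]eq_bigr => k _ do rewrite (proj2 (sigmaP k)) // /tau.
case: ifP => _.
  by rewrite sumr_const card_ord -scaler_nat scalerA mulVf ?pnatr_eq0 // scale1r.
congr (_ *: _); rewrite (big_nth 0%N) sT big_mkord.
(* For fixed [i], the index [i + k] modulo [p.+1] takes each value once as [k] varies, so every
   entry of [T] gets the same weight. *)
by rewrite (reindex_inj (addrI (Ordinal ip))).
Qed.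

(** The implications (ii) to (iii) and (iv) to (i) both rest on this descent. Writing the dimension
    as [p.+1] keeps the set averaged over nonempty. *)
Lemma cone_Sym_eucl p n A u :
  A `<=` eucl R p.+1 -> (3 * p.+1 <= n)%N ->
  cone (translates Sym A) u -> eucl R n u -> cone (translates (Symn n) A) u.
Proof.
move=> Ap pn [k [c [v [c0 Av uE]]]] un.
have ltpn : (p < n)%N by apply: leq_trans pn; rewrite leq_pmull.
(* One [w] must serve both vectors, so that its two contributions can cancel. The images of [p+1]
   under both permutations take at most 2(p+1) places, and the factor 3 leaves p+1 more for [T]. *)
have pair i j : exists w,
    cone (translates (Symn n) A) (trunc n (v i) + tail n (v i) *: w) /\
    cone (translates (Symn n) A) (trunc n (v j) + tail n (v j) *: w).
  have [s [/bij_inj sI _] [g Ag <-]] := Av i.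
  have [t [/bij_inj tI _] [h Ah <-]] := Av j.
  have [|T [Tuniq sT Tn T']] :=
      @fresh_seq p.+1 n (map s (iota 0 p.+1) ++ map t (iota 0 p.+1)).
    by rewrite size_cat !size_map size_iota addnn -muln2 -mulnSr mulnC.
  exists (p.+1%:R^-1 *: \sum_(t <- T) << t >>).
  split; apply: cone_trunc_tail => //; try exact: Ap.
    move=> a ap; apply/negP => /T'; rewrite mem_cat negb_or => /andP[/negP+ _].
    by apply; apply: map_f; rewrite mem_iota.
  move=> a ap; apply/negP => /T'; rewrite mem_cat negb_or => /andP[_ /negP].
  by apply; apply: map_f; rewrite mem_iota.
have [_ KD KZ] := cone_convex_cone (translates (Symn n) A).
rewrite -(trunc_eucl un) uE /trunc linear_sum.
under eq_bigr do rewrite linearZ /= -/(trunc n _).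
apply: (@convex_cone_elim _ _ _ _ (fun j => tail n (v j))) => //.
- rewrite -[RHS](tail_eucl un) uE /tail linear_sum.
  by apply: eq_bigr => j _; rewrite linearZ.
(* With zero tail the correction by [w] disappears, so the truncation itself lies in the cone. *)
- by move=> j tj; have [w [+ _]] := pair j j; rewrite tj scale0r addr0.
- move=> i j si sj; have [w [Kwi Kwj]] := pair i j.
  suff -> : - tail n (v j) *: trunc n (v i) + tail n (v i) *: trunc n (v j) =
      - tail n (v j) *: (trunc n (v i) + tail n (v i) *: w) +
      tail n (v i) *: (trunc n (v j) + tail n (v j) *: w).
    by apply: KD; apply: KZ => //; rewrite ?oppr_ge0 ltW.
  rewrite !scalerDr addrACA !scalerA -scalerDl mulNr [tail n (v j) * _]mulrC.
  by rewrite addNr scale0r addr0.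
Qed.

End Truncation.

(** * Monotonicity and limit of an invariant chain *)

Section Chains.
Context {R : realType} {Cn : nat -> set (seqspace R)}.
Context (Cchain : Sym_invariant_chain Cn).

Lemma chain_le m n : (0 < m)%N -> (m <= n)%N -> Cn m `<=` Cn n.
Proof.
move=> m0; elim: n => [|n IHn]; first by rewrite leqNgt m0.
rewrite leq_eqVlt ltnS => /predU1P[->//|mn].
by apply: subset_trans (IHn mn) _; case: (Cchain (leq_trans m0 mn)).
Qed.

Lemma chain_cone_translates n (A : set (seqspace R)) :
  (0 < n)%N -> A `<=` Cn n -> cone (translates (Symn n) A) `<=` Cn n.
Proof.
move=> n0 AC; have [_ Ccone Cinv _] := Cchain n0.
apply: cone_min => // _ [s sn [u Au <-]]; apply: Cinv.
by exists s => //; exists u => //; apply: AC.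
Qed.

Lemma chain_limit_convex_cone : convex_cone (chain_limit Cn).
Proof.
split.
- by exists 1%N => //; have [_ [C0 _ _] _ _] := Cchain (ltn0Sn 0).
- move=> u v [m /= m0 Cmu] [n /= n0 Cnv].
  have mn0 : (0 < maxn m n)%N by rewrite leq_max m0.
  exists (maxn m n) => //; have [_ [_ CD _] _ _] := Cchain mn0.
  by apply: CD; [apply: chain_le Cmu|apply: chain_le Cnv];
    rewrite ?leq_maxl ?leq_maxr.
- move=> a u a0 [n n0 Cnu]; exists n => //.
  by have [_ [_ _ CZ] _ _] := Cchain n0; apply: CZ.
Qed.

End Chains.

(** * Comparison of cones of translates, and vectors of small support *)

Lemma sub_translates (R : realType) (S : set (nat -> nat)) (A : set (seqspace R)) :
  S id -> A `<=` cone (translates S A).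
Proof.
by move=> Sid u Au; apply: sub_cone; exists id => //; exists u => //; apply: permact_id.
Qed.

Lemma cone_translates_mono (R : realType) (S T : set (nat -> nat))
    (A : set (seqspace R)) :
  S `<=` T -> cone (translates S A) `<=` cone (translates T A).
Proof.
by move=> ST; apply: cone_mono => _ [s /ST Ts [u Au <-]]; exists s => //; exists u.
Qed.

(** Here [t] sends [k] to the [k]-th element of the support and [s] is its inverse. This brings a
    generator of small support into the fixed space R^q and back. *)
Lemma permact_into_eucl (R : realType) (q n : nat) (u : seqspace R) :
  (q <= n)%N -> eucl R n u -> (support_size u <= q)%N ->
  exists s t, [/\ Symn n s, Symn n t, eucl R q (permact s u)
    & permact t (permact s u) = u].
Proof.
move=> qn un uq; pose d : seq nat := msupp u.
have du : uniq d by exact: fset_uniq.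
have dn i : i \in d -> (i < n)%N by rewrite -mcoeff_neq0; apply: eucl_msupp.
have sd : (size d <= n)%N by apply: leq_trans qn.
have [||t tn td] := @Symn_extend (size d) n (nth 0%N d) sd.
- by move=> i id; rewrite dn ?mem_nth.
- by move=> i j id jd /eqP; rewrite nth_uniq // => /eqP.
have [s sn [tK sK]] := Symn_inv tn.
exists s, t; split => //; last by rewrite permact_comp permact_id.
apply: eucl_permact => i; rewrite mcoeff_neq0 => iu.
have id : (index i d < size d)%N by rewrite index_mem.
by rewrite -(nth_index 0%N iu) -td // tK (leq_trans id uq).
Qed.

(** * The cycle of implications *)

Theorem theorem4p1 (R : realType) (Cn : nat -> set (seqspace R))
    (C : set (seqspace R)) :
  Sym_invariant_chain Cn -> C = chain_limit Cn ->
  [<-> (* (i) *)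
       stabilizes Cn /\
       (exists N, forall n, (0 < n)%N -> (N <= n)%N -> finitely_generated (Cn n));
       (* (ii) *)
       exists2 p, (0 < p)%N &
         exists G : set (seqspace R),
           [/\ finite_set G, G `<=` eucl R p
             & forall n, (p <= n)%N -> Cn n = cone (translates (Symn n) G)];
       (* (iii) *)
       exists2 q, (0 < q)%N &
         forall n, (q <= n)%N ->
           C `&` eucl R n = Cn n /\
           (exists A : set (seqspace R),
             [/\ finite_set A, forall u, A u -> (support_size u <= q)%N
               & Cn n = cone A]);
       (* (iv) *)
       Sym_equivariantly_fg C].
Proof.
move=> Cchain ->; tfae.
(* (i) to (ii): at an index past both thresholds, the generators of the cone serve as G. *)
- move=> [[r r0 Cstab] [N Cfg]]; pose p := maxn r N.
  have p0 : (0 < p)%N by rewrite (leq_trans r0) ?leq_maxl.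
  have [A Afin CA] := Cfg p p0 (leq_maxr r N).
  exists p => //; exists A; split => //.
    by case: (Cchain p p0) => + _ _ _; rewrite CA; apply: subset_trans; apply: sub_cone.
  by move=> n pn; rewrite (Cstab p n (leq_maxl r N) pn) CA cone_translates.
(* (ii) to (iii): the bound 3(p+1) is the one required by [cone_Sym_eucl]; it also exceeds the
   supports of all translates of [G]. *)
- move=> [[//|p] _ [G [Gfin Gp CG]]]; exists (3 * p.+1)%N => // n pn.
  have lepn : (p.+1 <= n)%N by apply: leq_trans pn; rewrite leq_pmull.
  have n0 : (0 < n)%N by apply: leq_trans lepn.
  split; last first.
    exists (translates (Symn n) G); split; last exact: CG.
    - by apply: finite_image2 => //; apply: finite_Symn.
    - move=> _ [s sn [g Gg <-]]; apply: leq_trans (support_size_permact _ _) _.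
      by apply: leq_trans (support_size_eucl (Gp _ Gg)) _; rewrite leq_pmull.
  apply/seteqP; split=> [u [[m /= m0 Cmu] un]|u Cu]; last first.
    by split; [exists n|case: (Cchain n n0) => + _ _ _; apply].
  rewrite CG //; apply: cone_Sym_eucl Gp pn _ un.
  apply: (cone_translates_mono (@Symn_Sym (maxn m p.+1))).
  by rewrite -CG ?leq_maxr //; apply: chain_le Cmu; rewrite ?leq_maxl.
(* (iii) to (iv): the generators [A] of [Cn q] generate the limit up to Sym. Each generator of
   [Cn n] is moved into R^q, where (a) places it in [Cn q], and is then moved back. *)
- move=> [q q0 Cq]; have [Cqq [A [Afin _ CA]]] := Cq q (leqnn q).
  exists A => //; apply/seteqP; split.
    move=> u [m /= m0 Cmu]; pose n := maxn m q.
    have qn : (q <= n)%N by exact: leq_maxr.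
    have n0 : (0 < n)%N by apply: leq_trans qn.
    have {Cmu} : Cn n u by apply: chain_le Cmu; rewrite ?leq_maxl.
    have [_ [B [_ Bq CB]]] := Cq n qn; rewrite CB.
    apply: cone_min; [exact: cone_convex_cone|move=> v Bv].
    have Cnv : Cn n v by rewrite CB; apply: sub_cone.
    have [Cn_eucl _ Cinv _] := Cchain n n0.
    have [s [t [sn tn sq <-]]] := permact_into_eucl qn (Cn_eucl _ Cnv) (Bq _ Bv).
    rewrite -cone_translates -CA; apply: sub_cone.
    exists t; first exact: Symn_Sym tn.
    exists (permact s v) => //; rewrite -Cqq; split=> //; exists n => //.
    by apply: Cinv; exists s => //; exists v.
  apply: cone_min; first exact: chain_limit_convex_cone.
  move=> _ [s /Sym_Symn[m sm] [u Au <-]]; pose n := maxn m q.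
  have n0 : (0 < n)%N by rewrite (leq_trans q0) ?leq_maxr.
  exists n => //; case: (Cchain n n0) => _ _ Cinv _; apply: Cinv.
  exists s; first exact: Symn_le (leq_maxl m q) sm.
  exists u => //; apply: (chain_le Cchain q0 (leq_maxr m q)).
  by rewrite CA; apply: sub_cone.
(* (iv) to (i): the finite set [A] already lies in one member of the chain, and its
   Sym(n)-translates generate [Cn n] from 3(p+1) on. *)
- move=> [A Afin CA].
  have [p [p0 Ap]] : exists p, (0 < p)%N /\ A `<=` Cn p.
    have [||p pP] := finite_set_bound (P := fun u n => (0 < n)%N /\ Cn n u) Afin.
    + move=> u m n mn [m0 Cu]; split; first exact: leq_trans mn.
      exact: chain_le Cu.
    + move=> u Au; have [n n0 Cnu] : chain_limit Cn u.
        by rewrite CA; apply: sub_translates Au; apply: (@Symn_Sym 0); exact: Symn_id.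
      by exists n.
    (* For empty [A] the bound [p] may be 0; its successor is always a positive index. *)
    exists p.+1; split => // u /pP[p0]; exact: chain_le.
  case: p => // p in p0 Ap *.
  have AE : A `<=` eucl R p.+1.
    by apply: subset_trans Ap _; case: (Cchain _ p0).
  have CE n : (3 * p.+1 <= n)%N -> Cn n = cone (translates (Symn n) A).
    move=> pn; have lepn : (p.+1 <= n)%N by apply: leq_trans pn; rewrite leq_pmull.
    have n0 : (0 < n)%N by apply: leq_trans lepn.
    apply/seteqP; split; last first.
      by apply: chain_cone_translates => //; apply: subset_trans (chain_le Cchain p0 lepn).
    move=> u Cu; apply: cone_Sym_eucl AE pn _ _.
      by rewrite -CA; exists n.
    by case: (Cchain n n0) => + _ _ _; apply.
  split; last first.
    exists (3 * p.+1)%N => n _ pn; exists (translates (Symn n) A); last exact: CE.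
    by apply: finite_image2 => //; apply: finite_Symn.
  exists (3 * p.+1)%N => // m n pm mn.
  have m0 : (0 < m)%N by apply: leq_trans pm.
  have n0 : (0 < n)%N by apply: leq_trans mn.
  (* Since [A] lies in [Cn m], the translates of [A] that generate [Cn n] are among those of
     [Cn m]. *)
  apply/seteqP; split; last by apply: chain_cone_translates => //; apply: chain_le.
  rewrite (CE n (leq_trans pm mn)); apply: cone_mono => _ [s sn [u Au <-]].
  exists s => //; exists u => //; rewrite CE //.
  by apply: sub_translates Au; apply: Symn_id.
Qed.
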